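(* Let $S\subseteq\omega_1$ be stationary and co-stationary, and let $T=T(S)$. Then there is a subgraph $X$ of the comparability graph $G(T)$ such that $Chr(X)=\omega_1$ and $X$ contains no uncountable $\omega$-connected subsets; that is, for every uncountable set $A$ of vertices of $X$ there are two vertices $s,t\in A$ and a finite set $F\subseteq A$ such that every path between $s$ and $t$ all of whose vertices lie in $A$ passes through $F$.
   Context: $T(S)$ denotes the tree of all closed (in the order topology of $\omega_1$) countable subsets $t\subseteq S$, ordered by $s\leq t$ iff $s$ is an initial segment of $t$. For a tree $(T,\leq)$, the comparability graph $G(T)$ has vertex set $T$ and an edge between distinct $x,y$ iff $x\leq y$ or $y\leq x$. $Chr(X)$ is the chromatic number: the least cardinal $\kappa$ such that the vertex set of $X$ is a union of $\kappa$ independent sets. A set $F$ of vertices separates vertices $s,t$ in a graph if every path from $s$ to $t$ meets $F$; a graph is $\omega$-connected if no finite set of vertices separates two of its vertices; a set of vertices is $\omega$-connected if the subgraph it induces is $\omega$-connected. *)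

(* Defs.v *)
From HB Require Import structures.
From mathcomp Require Import all_boot all_order.
From mathcomp Require Import all_classical wochoice.
From mathcomp Require Import topology.

Set Implicit Arguments.
Unset Strict Implicit.
Unset Printing Implicit Defensive.

Import Order.TTheory.
Local Open Scope classical_set_scope.
Local Open Scope card_scope.

(* The ordinal omega_1 is any uncountable well-ordered set all of whose proper
   initial segments are countable: this determines the order up to isomorphism,
   and [omega1_exists] below provides one.  By definition, the topology of an
   [orderTopologicalType] is its order topology. *)
Definition is_omega1 d (W : orderTopologicalType d) : Prop :=
  [/\ well_order (<=%O : rel W), ~ countable [set: W]
    & forall a : W, countable [set x : W | (x < a)%O]].

Section ClubsAndTree.
Context d (W : orderTopologicalType d).

Definition unbounded (C : set W) : Prop :=
  forall a : W, exists2 b, C b & (a < b)%O.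

Definition club (C : set W) : Prop := closed C /\ unbounded C.

Definition stationary (S : set W) : Prop :=
  forall C : set W, club C -> S `&` C !=set0.

Definition closed_countable_subsets (S : set W) : set (set W) :=
  [set t | [/\ t `<=` S, countable t & closed t]].

Definition initial_segment (s t : set W) : Prop :=
  s `<=` t /\ forall x y : W, t x -> s y -> (x <= y)%O -> s x.

End ClubsAndTree.

(* Simple graphs; the vertex set is a subset of the ambient type [V]. *)
Record graph (V : eqType) := Graph {
  vertices : set V;
  edge : rel V;
  edge_sym : symmetric edge;
  edge_irr : irreflexive edge;
  edge_vertices : forall x y, edge x y -> vertices x /\ vertices y }.

Section Graphs.
Context (V : eqType).
Implicit Types (G H : graph V) (T A F U : set V).

Definition subgraph H G : Prop :=
  vertices H `<=` vertices G /\ forall x y, edge H x y -> edge G x y.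

Section Comparability.
Context T (le : V -> V -> Prop).

Definition comparability_edge : rel V :=
  fun x y => `[< [/\ T x, T y, x <> y & le x y \/ le y x] >].

Fact comparability_edge_sym : symmetric comparability_edge.
Proof.
move=> x y; apply: asbool_equiv_eq; split=> -[Tx Ty nxy lexy];
  by split=> //; [exact: nesym | case: lexy; [right | left]].
Qed.

Fact comparability_edge_irr : irreflexive comparability_edge.
Proof. by move=> x; apply/asboolP => -[]. Qed.

Fact comparability_edge_vertices x y : comparability_edge x y -> T x /\ T y.
Proof. by move=> /asboolP[]. Qed.

Definition comparability_graph : graph V :=
  Graph comparability_edge_sym comparability_edge_irr
    comparability_edge_vertices.

End Comparability.

Section Induced.
Context G A.

Definition induced_edge : rel V :=
  fun x y => [&& edge G x y, x \in A & y \in A].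

Fact induced_edge_sym : symmetric induced_edge.
Proof.
by move=> x y; rewrite /induced_edge (@edge_sym _ G); congr (_ && _); exact: andbC.
Qed.

Fact induced_edge_irr : irreflexive induced_edge.
Proof. by move=> x; rewrite /induced_edge edge_irr. Qed.

Fact induced_edge_vertices x y :
  induced_edge x y -> (vertices G `&` A) x /\ (vertices G `&` A) y.
Proof.
by move=> /and3P[/edge_vertices[Gx Gy] /set_mem Ax /set_mem Ay]; split; split.
Qed.

Definition induced : graph V :=
  Graph induced_edge_sym induced_edge_irr induced_edge_vertices.

End Induced.

Definition independent G U : Prop :=
  U `<=` vertices G /\ forall x y, U x -> U y -> ~~ edge G x y.

Definition union_of_independent G (K : Type) : Prop :=
  exists2 U : K -> set V, (forall k, independent G (U k)) &
    \bigcup_k U k = vertices G.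

(* The chromatic number of [G] is the cardinality of the type [K]. *)
Definition chromatic_number_is G (K : Type) : Prop :=
  union_of_independent G K /\
  forall K' : Type, union_of_independent G K' -> [set: K] #<= [set: K'].

Definition separates G F (s t : V) : Prop :=
  forall p : seq V, path (edge G) s p -> uniq (s :: p) -> last s p = t ->
    exists2 z, z \in s :: p & F z.

(* As usual, a separating set must avoid the two vertices that it separates:
   otherwise [set s] would always separate s from t. *)
Definition omega_connected G : Prop :=
  ~ exists (s t : V) (F : set V),
      [/\ vertices G s, vertices G t, s <> t
        & [/\ F `<=` vertices G `\` [set s; t], finite_set F
            & separates G F s t]].

End Graphs.

Section Omega1Exists.

Definition wo_sub (T : choiceType) (P : pred T) (R : rel T)
  of well_order R : Type := {x : T | P x}.

Section WoSub.
Context (T : choiceType) (P : pred T) (R : rel T) (woR : well_order R).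
Local Notation W := (wo_sub P woR).

HB.instance Definition _ := Choice.copy W {x : T | P x}.

Let woT : wo_chain R predT. Proof. by move=> A _; exact: woR. Qed.

Lemma wo_total x y : R x y || R y x.
Proof. exact: (wo_chainW woT). Qed.

Let Rrefl x : R x x.
Proof. by rewrite -[R x x]orbb wo_total. Qed.

Lemma wo_anti : antisymmetric R.
Proof. by move=> x y; exact: (wo_chain_antisymmetric woT). Qed.

Lemma wo_trans : transitive R.
Proof.
move=> y x z Rxy Ryz.
have [|m [[mA mlb] _]] := woR (A := pred3 x y z); first by exists x; rewrite inE /= eqxx.
have [Rmx Rmy Rmz]: [/\ R m x, R m y & R m z].
  by split; apply: mlb; rewrite inE /= eqxx ?orbT.
case/or3P: mA => /eqP em; rewrite {}em {m mlb} in Rmx Rmy Rmz => //.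
- by rewrite (wo_anti (x := x) (y := y)) ?Rxy.
- by rewrite -(wo_anti (x := y) (y := z)) ?Ryz.
Qed.

Let leW (x y : W) : bool := R (proj1_sig x) (proj1_sig y).

Let leW_refl : reflexive leW. Proof. by move=> x; exact: Rrefl. Qed.
Let leW_anti : antisymmetric leW.
Proof. by move=> x y xy; apply: val_inj; exact: wo_anti. Qed.
Let leW_trans : transitive leW.
Proof. by move=> x y z; exact: wo_trans. Qed.
Let leW_total : total leW. Proof. by move=> x y; exact: wo_total. Qed.

HB.instance Definition _ := Order.Le_isPOrder.Build
  Order.default_display W leW_refl leW_anti leW_trans.
HB.instance Definition _ := Order.POrder_isTotal.Build
  Order.default_display W leW_total.

Lemma wo_sub_leE (x y : W) : (x <= y)%O = R (proj1_sig x) (proj1_sig y).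
Proof. by []. Qed.

Lemma wo_sub_well_order : well_order (<=%O : rel (order_topology W)).
Proof.
apply: antisymmetric_well_order; first exact: le_anti.
move=> A [a Aa].
pose B : {pred T} := [pred x | `[< exists2 w : W, w \in A & proj1_sig w = x >]].
have [|m [[/asboolP[w Aw wm] mlb] _]] := woR (A := B).
  by exists (proj1_sig a); apply/asboolP; exists a.
exists w; split=> // v Av; rewrite (_ : (w <= v)%O = R (proj1_sig w) (proj1_sig v)) // wm; apply: mlb.
by apply/asboolP; exists v.
Qed.

End WoSub.

Lemma wo_sub_countable (T : choiceType) (P : pred T) (R : rel T)
    (woR : well_order R) (A : set (order_topology (wo_sub P woR))) (B : set T) :
  (forall w, A w <-> B (proj1_sig w)) -> (forall x, B x -> P x) ->
  countable A <-> countable B.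
Proof.
move=> AB BP.
suff BA : B #= A by split; apply: sub_countable; move: BA; rewrite card_eq_le => /andP[].
have -> : B = (fun w : order_topology (wo_sub P woR) => proj1_sig w) @` A.
  apply/seteqP; split=> [x Bx|_ [w /AB Bw <-]//].
  by exists (exist _ x (BP x Bx)) => //; apply/AB.
apply: inj_card_eq => v w _ _; exact: val_inj.
Qed.

Lemma omega1_exists : exists d (W : orderTopologicalType d), is_omega1 W.
Proof.
have [R woR] := well_ordering_principle (set nat : choiceType).
have uncT : ~ countable [set: set nat].
  move=> /countable_injP[f finj].
  pose D : set nat := [set n | exists2 X : set nat, f X = n & ~ X n].
  have DD : ~ D (f D).
    move=> /[dup] DfD [X fX]; have -> : X = D by apply: finj; rewrite ?inE.
    by [].
  by apply: (DD); exists D.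
pose seg a := [set x | R x a && (x != a)].
have [[a ua]|allc] := pselect (exists a, ~ countable (seg a)); last first.
  exists Order.default_display, (order_topology (wo_sub predT woR)); split.
  - exact: wo_sub_well_order.
  - move=> c; apply: uncT; apply: (wo_sub_countable (B := setT) _ _).1 c; by [].
  - move=> a; apply: (wo_sub_countable (B := seg (proj1_sig a)) _ _).2 => //.
    + by move=> w; rewrite /= lt_neqAle andbC.
    + by apply: contrapT => ?; apply: allc; exists (proj1_sig a).
have [|m [[/asboolP um mlb] _]] := woR [pred x | `[< ~ countable (seg x) >]].
  by exists a; apply/asboolP.
pose P := [pred x | R x m && (x != m)].
exists Order.default_display, (order_topology (wo_sub P woR)); split.
- exact: wo_sub_well_order.
- move=> c; apply: um.
  apply: (wo_sub_countable (B := seg m) _ _).1 c => // w.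
  by split=> // _; exact: (svalP w).
- move=> [b Pb]; have /andP[Rbm nbm] := Pb.
  apply: (wo_sub_countable (B := seg b) _ _).2.
  + by move=> w; rewrite /= lt_neqAle andbC.
  + move=> x /andP[Rxb nxb]; rewrite inE (wo_trans woR Rxb Rbm)/=.
    apply: contra_neq nxb => xm; apply: (wo_anti woR).
    by rewrite Rxb xm.
  + apply: contrapT => ub; move/eqP: nbm; apply; apply: (wo_anti woR).
    by rewrite Rbm mlb//; apply/asboolP.
Qed.

End Omega1Exists.

(* Main.v *)
(* Label the countable ordinals by natural numbers so that every label occurs
   unboundedly often in S.  Join r to x > r when, g being the first point of x
   above r, every later point of x that is not a limit of points of x has a
   larger label than g.  Whether r and x are joined is decided, for all x above
   a node s > r, by s alone, so the paths leaving the cone above s pass through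
   the down-neighbours of s.  These have increasing labels; if s is not a limit
   node, its last label bounds them, hence they are finitely many.

   If A is uncountable and omega-connected, then almost all of A lies in the
   cone above each non-limit s that has an element of A above it.  Such s form a
   chain, which is bounded because S contains no club, so two distinct limit
   nodes of A lie above all of them; but a limit node is determined by the
   non-limit nodes below it.

   Given a colouring of the tree by natural numbers, stationarity of S yields a
   node x that is the limit of a sequence of nodes t_n joined to it, where t_n
   was chosen of colour n whenever the labels allowed it; if n is the colour of
   x, they did, so t_n and x have the same colour. *)

Require Import Defs.
From HB Require Import structures.
From mathcomp Require Import all_boot all_order interval.
From mathcomp Require Import all_classical.
From mathcomp Require Import topology.

Set Implicit Arguments.
Unset Strict Implicit.
Unset Printing Implicit Defensive.

Import Order.TTheory.
Local Open Scope classical_set_scope.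

(** * Countable and uncountable sets *)

Lemma countable_subset T (A B : set T) : A `<=` B -> countable B -> countable A.
Proof. by move=> /subset_card_le; exact: sub_countable. Qed.

Lemma countable_range (T : countType) U (f : T -> U) : countable (range f).
Proof. exact: sub_countable (card_image_le f setT) (countableP _). Qed.

Lemma countable_inj_image T U (A : set T) (B : set U) (f : T -> U) :
  (forall x, A x -> B (f x)) ->
  (forall x y, A x -> A y -> f x = f y -> x = y) -> countable B -> countable A.
Proof.
move=> AB f_inj /countable_injP[g g_inj]; apply/countable_injP.
exists (g \o f) => x y /set_mem Ax /set_mem Ay /g_inj gf; apply: f_inj => //.
by apply: gf; apply/mem_set/AB.
Qed.

Lemma countable_enumeration T (A : set T) : countable A -> A !=set0 ->
  exists g : nat -> T, (forall n, A (g n)) /\ forall x, A x -> exists n, g n = x.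
Proof.
move=> /countable_injP[e e_inj] [x0 Ax0].
have gP n : exists y, A y /\ forall x, A x -> e x = n -> y = x.
  have [[x [Ax exn]]|nx] := pselect (exists x, A x /\ e x = n).
    by exists x; split=> // y Ay eyn; apply: e_inj; rewrite ?inE// exn.
  by exists x0; split=> // y Ay eyn; case: nx; exists y.
have [g {}gP] := choice gP; exists g; split=> [n|x Ax]; first exact: (gP n).1.
by exists (e x); exact: (gP (e x)).2.
Qed.

Lemma countable_setU T (A B : set T) :
  countable A -> countable B -> countable (A `|` B).
Proof.
move=> cA cB; rewrite -bigcup2E; apply: bigcup_countable => // -[|[|n]] _ //=.
Qed.

Lemma uncountable_setD T (A B : set T) :
  ~ countable A -> countable B -> ~ countable (A `\` B).
Proof.
move=> uA cB cAB; apply: uA; apply: countable_subset (countable_setU cAB cB).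
by move=> x Ax; have [Bx|nBx] := pselect (B x); [right|left].
Qed.

Lemma uncountable_infinite T (A : set T) : ~ countable A -> infinite_set A.
Proof. by move=> uA /finite_set_countable. Qed.

Lemma uncountable_neq0 T (A : set T) : ~ countable A -> A !=set0.
Proof. by move=> /uncountable_infinite; exact: infinite_setN0. Qed.

(** * Order, topology and clubs of [omega_1] *)

Section Omega1.
Context d (W : orderTopologicalType d).
Hypothesis W_omega1 : is_omega1 W.
Implicit Types (A C s t : set W) (a b x y z : W).

Lemma omega1_uncountable : ~ countable [set: W].
Proof. by have [_ uW _] := W_omega1. Qed.

Lemma omega1_countable_lt a : countable [set x : W | (x < a)%O].
Proof. by have [_ _ cW] := W_omega1. Qed.

Lemma omega1_min A : A !=set0 -> exists2 m, A m & forall y, A y -> (m <= y)%O.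
Proof.
move=> [x Ax]; have [wo _ _] := W_omega1.
have [|m [[/asboolP Am minm] _]] := wo [pred y | `[< A y >]].
  by exists x; apply/asboolP.
by exists m => // y Ay; apply: minm; apply/asboolP.
Qed.

Lemma omega1_wf : well_founded (fun x y : W => x < y)%O.
Proof.
move=> x; apply: contrapT => nx.
have [|m nm minm] := @omega1_min [set y | ~ Acc (fun x y : W => x < y)%O y].
  by exists x.
apply: nm; constructor => y ym; apply: contrapT => /minm.
by rewrite leNgt ym.
Qed.

(** Otherwise [W] would be the union of the countable initial segments ending at points of [A]. *)
Lemma omega1_above_countable A : countable A -> exists b, forall x, A x -> (x < b)%O.
Proof.
move=> cA; have [_ uW cW] := W_omega1.
apply: contrapT => nb; apply: uW.
apply: (@countable_subset _ _ (\bigcup_(x in A) ([set y | (y < x)%O] `|` [set x]))).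
  move=> b _; have [[x [Ax xb]]|nx] := pselect (exists x, A x /\ (b <= x)%O).
    exists x => //; case: ltgtP xb => //= [?|->] _; [by left|by right].
  exfalso; apply: nb; exists b => x Ax; rewrite ltNge; apply/negP => bx.
  by apply: nx; exists x.
apply: bigcup_countable => // x _; exact: countable_setU.
Qed.

Lemma omega1_above a : exists b, (a < b)%O.
Proof. by have [b /(_ a erefl)] := omega1_above_countable (countable1 a); exists b. Qed.

Lemma omega1_countable_le a : countable [set x | (x <= a)%O].
Proof.
have [b ab] := omega1_above a; have [_ _ cW] := W_omega1.
by apply: countable_subset (cW b) => x /= /le_lt_trans; apply.
Qed.

Lemma omega1_sup A : countable A ->
  exists2 b, (forall x, A x -> (x <= b)%O)
    & forall z, (z < b)%O -> exists2 x, A x & (z < x)%O.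
Proof.
move=> /omega1_above_countable[b Ab].
have [|m Am minm] := @omega1_min [set m | forall x, A x -> (x <= m)%O].
  by exists b => x /Ab /ltW.
exists m => // z zm; apply: contrapT => nx; move: zm; rewrite ltNge minm// => x Ax.
by rewrite leNgt; apply/negP => zx; apply: nx; exists x.
Qed.

Definition limit_of A y :=
  (exists z, (z < y)%O) /\
  forall z, (z < y)%O -> exists w, [/\ A w, (z < w)%O & (w < y)%O].

Lemma sub_limit_of A C y : (forall w, (w < y)%O -> A w -> C w) ->
  limit_of A y -> limit_of C y.
Proof.
move=> AC [z0 Ay]; split=> // z /Ay[w [Aw zw wy]].
by exists w; split=> //; exact: AC.
Qed.

Lemma limit_of_max A y : limit_of A y -> exists2 z, A z & (z < y)%O.
Proof. by move=> [[z zy]] /(_ z zy)[w [Aw _ wy]]; exists w. Qed.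

(** This trades the order topology for a condition on suprema, the only form in which closedness is
    used below. *)
Lemma closed_limitP A : closed A <-> forall y, limit_of A y -> A y.
Proof.
split=> [cA y Ay|Alim y cAy].
  suff [] : (A `&` [set` `]-oo, y]%O]) y by [].
  apply: itv_closed_supremums.
  - have [z Az zy] := limit_of_max Ay; exists z; split=> //=.
    by rewrite in_itv/= ltW.
  - by apply: closedI => //; exact: lray_closed.
  - split=> [x [_ /=]|z ubz]; first by rewrite in_itv.
    rewrite leNgt; apply/negP => /Ay.2[w [Aw zw wy]].
    have : (w <= z)%O by apply: ubz; split=> //=; rewrite in_itv/= ltW.
    by rewrite leNgt zw.
apply: contrapT => nAy; apply: (nAy); apply: Alim.
have [y' yy'] := omega1_above y.
(* [b] is the successor of [y], so the open ray below [b] is a neighbourhood of [y] with no point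
   above [y]. *)
have [|b yb minb] := @omega1_min [set b | (y < b)%O]; first by exists y'.
have below (U : set W) : open U -> U y -> exists w, [/\ A w, U w & (w < y)%O].
  move=> oU Uy; have [|w [Aw [Uw /=]]] := cAy (U `&` [set` `]-oo, b[%O]).
    apply: open_nbhs_nbhs; split; first by apply: openI => //; exact: lray_open.
    by split=> //=; rewrite in_itv.
  rewrite in_itv/= => wb; exists w; split=> //.
  case: (ltgtP w y) => [//|yw|wy]; last by rewrite wy in Aw.
  by move: wb; rewrite ltNge minb.
split; first by have [w [_ _ wy]] := below setT openT I; exists w.
move=> z zy; have [|w [Aw /=]] := below [set` `]z, +oo[%O] (rray_open z).
  by rewrite /= in_itv/= zy.
by rewrite in_itv/= andbT; exists w.
Qed.

(** A finite list below a limit of closure points is already below one of them, which gives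
    closedness. A closure point above [a] is the supremum of [omega] iterates of a function bounding
    [F]. *)
Lemma finite_closed_under_closure_points (F : seq W -> W) :
  club [set c | forall l, all (fun x => x < c)%O l -> (F l < c)%O].
Proof.
split.
  apply/closed_limitP => y [[z0 z0y] Cy] l ly.
  have [z zy lz] : exists2 z, (z < y)%O & all (fun x => x <= z)%O l.
    elim: l ly => [|x l IH] /=; first by exists z0.
    move=> /andP[xy /IH[z zy lz]]; case: (leP x z) => xz.
      by exists z; rewrite ?xz.
    exists x => //; rewrite lexx/=; apply: sub_all lz => v vz.
    exact: le_trans vz (ltW xz).
  have [w [Cw zw wy]] := Cy z zy.
  apply: lt_trans wy; apply: Cw; apply: sub_all lz => v /le_lt_trans; exact.
(* Only countably many lists have all their entries below [x], so the values of [F] on them are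
   bounded. *)
move=> a; have bound x : exists y, (x < y)%O /\
    forall l, all (fun v => v < x)%O l -> (F l < y)%O.
  have [|g [_ gs]] := countable_enumeration (omega1_countable_le x).
    by exists x => /=.
  have eP v : exists n, (v <= x)%O -> g n = v.
    have [/gs[n gn]|nv] := pselect (v <= x)%O; first by exists n.
    by exists 0%N.
  have [e {}eP] := choice eP; have [y yP] := omega1_above_countable
    (countable_setU (countable1 x) (countable_range (F \o map g))).
  exists y; split=> [|l lx]; first by apply: yP; left.
  apply: yP; right; exists (map e l) => //=; congr F.
  rewrite -map_comp -[RHS]map_id; apply/eq_in_map => v /(allP lx) vx.
  by apply: eP; exact: ltW.
have [phi phiP] := choice bound.
pose c n := iter n phi (phi a).
have [b cb bc] := omega1_sup (countable_range c).
have c_lt n : (c n < c n.+1)%O by apply: (phiP _).1.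
have c_ltb n : (c n < b)%O by apply: lt_le_trans (c_lt n) _; apply: cb; exists n.+1.
have c_le : {homo c : m n / (m <= n)%N >-> (m <= n)%O}.
  by apply: homo_leq; [exact: lexx|exact: le_trans|move=> n; exact/ltW].
exists b; last by apply: lt_trans (c_ltb 0%N); exact: (phiP _).1.
move=> l lb; suff [n ln] : exists n, all (fun x => x < c n)%O l.
  by apply: lt_trans (c_ltb n.+1); exact: (phiP _).2.
elim: l lb => [|x l IH] /=; first by exists 0%N.
move=> /andP[/bc[_ [m _ <-] xm] /IH[n ln]].
exists (maxn m n); rewrite (lt_le_trans xm) ?c_le ?leq_maxl//=.
by apply: sub_all ln => v /lt_le_trans; apply; rewrite c_le ?leq_maxr.
Qed.

(** Recursion along [W]: before stage [a] only countably many elements are used up, so infinitely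
    many elements of [D a] are left. It serves both to label [S] and to embed [W] into any
    uncountable type. *)
Lemma disjoint_sequences (K : Type) (D : W -> set K) :
  (forall a, ~ countable (D a)) ->
  exists G : W -> nat -> K, (forall a n, D a (G a n)) /\
    forall a b m n, G a m = G b n -> a = b /\ m = n.
Proof.
move=> uD; have [_ _ cW] := W_omega1.
(* [aP.2] stands for the elements already used; when it is uncountable, which does not occur in the
   recursion, [g] is a dummy constant. *)
have pickP (aP : W * set K) : exists g : nat -> K, countable aP.2 ->
    injective g /\ forall n, (D aP.1 `\` aP.2) (g n).
  case: aP => a P /=; have [cP|ncP] := pselect (countable P); last first.
    by have [k _] := uncountable_neq0 (uD a); exists (fun=> k).
  have /infiniteP/card_leP[g] := uncountable_infinite (uncountable_setD (uD a) cP).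
  exists (fun n => set_val (g (to_setT n))) => _; split=> [m n /val_inj gmn|n].
    have /= := @inj _ _ setT g (to_setT m) (to_setT n).
    by rewrite !inE => /(_ I I gmn) [].
  by apply: set_mem; exact: (valP (g (to_setT n))).
have [pick {}pickP] := choice pickP.
pose step a (rec : forall b, (b < a)%O -> nat -> K) : nat -> K :=
  pick (a, [set k | exists b (ba : (b < a)%O) n, rec b ba n = k]).
pose G := Fix omega1_wf (fun=> nat -> K) step.
pose prev a := \bigcup_(b in [set b | (b < a)%O]) range (G b).
have GE a : G a = pick (a, prev a).
  rewrite /G Fix_eq => [|x f g fg]; last first.
    by congr step; apply: functional_extensionality_dep => b; apply: funext => ba.
  congr (pick (_, _)); apply/seteqP; split=> k /=.
    by move=> [b [ba [n <-]]]; exists b => //; exists n.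
  by move=> [b /= ba [n _ <-]]; exists b, ba, n.
have cprev a : countable (prev a).
  apply: bigcup_countable => [|b _]; last exact: countable_range.
  by have [_ _] := W_omega1; apply.
have GP a n : (D a `\` prev a) (G a n) by rewrite GE; exact: (pickP (a, _) (cprev a)).2.
exists G; split=> [a n|a b m n Gab]; first by have [] := GP a n.
case: (ltgtP a b) => [ab|ba|eab].
- by case: (GP b n) => _ []; exists a => //; exists m.
- by case: (GP a m) => _ []; exists b => //; exists n.
- split=> //; move: Gab; rewrite -eab GE; exact: (pickP (a, _) (cprev a)).1.
Qed.

(** * Initial segments *)

Lemma iseg_refl t : initial_segment t t.
Proof. by split. Qed.

Lemma iseg_trans s r t :
  initial_segment r s -> initial_segment s t -> initial_segment r t.
Proof.
move=> [rs rsi] [st sti]; split=> [|x y tx ry xy]; first exact: subset_trans st.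
by apply: (rsi _ y) => //; apply: (sti _ y) => //; exact: rs.
Qed.

Lemma iseg_total s r t :
  initial_segment s t -> initial_segment r t ->
  initial_segment s r \/ initial_segment r s.
Proof.
move=> [st sti] [rt rti]; have [sr|/existsNP[y /not_implyP[sy nry]]] := pselect (s `<=` r).
  by left; split=> // x y /rt; exact: sti.
have rs : r `<=` s.
  move=> z rz; apply: (sti _ y) => //; first exact: rt.
  by rewrite leNgt; apply/negP => /ltW yz; apply: nry; apply: (rti _ z) => //; exact: st.
by right; split=> // x z /st; exact: rti.
Qed.

Lemma iseg_limit s t z y : initial_segment s t -> s z -> (y <= z)%O ->
  limit_of t y -> limit_of s y.
Proof.
move=> [_ sti] sz yz; apply: sub_limit_of => w /ltW wy tw.
by apply: (sti _ z) => //; exact: le_trans yz.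
Qed.

Definition max_of t x := t x /\ forall y, t y -> (y <= x)%O.

(** * The tree of closed countable subsets and the ladder graph on it *)

Section Tree.
Variables (S : set W) (h : W -> nat).

(** The empty set is left out so that every node has a maximum. *)
Definition node : set (set W) :=
  [set t | closed_countable_subsets S t /\ t !=set0].

(** Limit points of [x] are exempt because the label of the supremum added in [ladder_monochromatic]
    cannot be prescribed. *)
Definition below (r x : set W) := exists g,
  [/\ x g, r = [set y | x y /\ (y < g)%O]
    & forall y, x y -> (g < y)%O -> ~ limit_of x y -> (h g < h y)%N].

Lemma node_limit t y : node t -> limit_of t y -> t y.
Proof. by move=> [[_ _ ct] _]; move: y; exact/closed_limitP. Qed.

Lemma node_max t : node t -> exists x, max_of t x.
Proof.
move=> nt; have [[_ ct _] [y0 ty0]] := nt; have [b tb bt] := omega1_sup ct.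
exists b; split=> //; apply: contrapT => ntb; apply: (ntb); apply: (node_limit nt).
have tlt y : t y -> (y < b)%O.
  by move=> ty; rewrite lt_neqAle tb// andbT; apply/eqP => yb; rewrite yb in ty.
split; first by exists y0; exact: tlt.
by move=> z /bt[w tw zw]; exists w; split=> //; exact: tlt.
Qed.

Lemma iseg_trunc t b : initial_segment [set y | t y /\ (y <= b)%O] t.
Proof.
split=> [y []//|x y tx [_ yb] xy]; split=> //; exact: le_trans yb.
Qed.

Lemma node_trunc t b : node t -> t b -> node [set y | t y /\ (y <= b)%O].
Proof.
move=> nt tb; have [[tS ct _] _] := nt; split; last by exists b.
split; [by move=> y [/tS]|by apply: countable_subset ct => y []|].
apply/closed_limitP => y ly; split.
  by apply: (node_limit nt); apply: sub_limit_of ly => w _ [].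
rewrite leNgt; apply/negP => /ly.2[w [[_ wb] bw _]].
by move: wb; rewrite leNgt bw.
Qed.

Lemma node_add t x g : node t -> max_of t x -> (x < g)%O -> S g ->
  node (t `|` [set g]).
Proof.
move=> nt [tx mx] xg Sg; have [[tS ct _] _] := nt.
split; last by exists g; right.
split; [by move=> y [/tS|->]|exact: countable_setU (countable1 g)|].
apply/closed_limitP => y ly; have [yg|gy] := leP y g.
  left; apply: (node_limit nt); apply: sub_limit_of ly => w wy [//|wg].
  by move: wy; rewrite wg ltNge yg.
have [w [[tw|->] gw _]] := ly.2 g gy; last by move: gw; rewrite ltxx.
by move: gw; rewrite ltNge (le_trans (mx _ tw)) ?ltW.
Qed.

Lemma iseg_below (r x : set W) : below r x -> initial_segment r x.
Proof.
move=> [g [xg -> _]]; split=> [y []//|z y xz [_ yg] zy]; split=> //.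
exact: le_lt_trans yg.
Qed.

Lemma below_irr (x : set W) : ~ below x x.
Proof. by move=> [g [+ xE _]]; rewrite xE => -[_]; rewrite ltxx. Qed.

Lemma below_proper (r x : set W) : below r x -> ~ initial_segment x r.
Proof.
by move=> [g [xg -> _]] [/(_ _ xg)[_]]; rewrite ltxx.
Qed.

(** The point [g] ending [r] lies in [s], since otherwise [s] would be an initial segment of [r].
    The label condition passes from [x] to [s] because both have the same limit points up to any
    point of [s]. *)
Lemma below_exit (s x r : set W) : initial_segment s x -> below r x ->
  ~ initial_segment s r -> below r s.
Proof.
move=> sx; have [sx1 sxi] := sx => -[g [xg -> gP]] nsr.
have sg : s g.
  apply: contrapT => nsg; apply: nsr; split=> [y sy|z y [xz _]]; last exact: sxi.
  split; first exact: sx1.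
  by rewrite ltNge; apply/negP => gy; apply: nsg; exact: sxi gy.
exists g; split=> //.
  apply/seteqP; split=> y [xy yg]; split=> //; last exact: sx1.
  exact: sxi xy sg (ltW yg).
move=> y sy gy nly; apply: gP => //; first exact: sx1.
by move=> /(iseg_limit sx sy (lexx y)).
Qed.

Lemma finite_below s x : node s -> max_of s x -> ~ limit_of s x ->
  finite_set [set r | node r /\ below r s].
Proof.
move=> ns [sx mx] nlx.
pose G := [set g | [/\ s g, node [set y | s y /\ (y < g)%O]
    & forall y, s y -> (g < y)%O -> ~ limit_of s y -> (h g < h y)%N]].
suff finG : finite_set G.
  apply: sub_finite_set (finite_image (fun g => [set y | s y /\ (y < g)%O]) finG).
  by move=> r [nr [g [sg rE gP]]]; exists g => //; split=> //; rewrite -rE.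
have h_lt g g' : G g -> G g' -> (g < g')%O -> (h g < h g')%N.
  (* If [g'] were a limit of [s], it would be a limit of the node formed by the points of [s] before
     [g'], which is closed and misses [g']. *)
  move=> [_ _ gP] [sg' ng' _] gg'; apply: gP => // lg'.
  suff [_] : [set y | s y /\ (y < g')%O] g' by rewrite ltxx.
  by apply: (node_limit ng'); apply: sub_limit_of lg'.
have h_inj : {in G &, injective h}.
  move=> g g' /set_mem Gg /set_mem Gg' hgg'; case: (ltgtP g g') => // gg'.
    by have := h_lt _ _ Gg Gg' gg'; rewrite hgg' ltnn.
  by have := h_lt _ _ Gg' Gg gg'; rewrite hgg' ltnn.
rewrite -(eq_finite_set (inj_card_eq h_inj)).
apply: sub_finite_set (finite_II (h x).+1) => _ [g [sg _ gP] <-] /=.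
rewrite ltnS; move: (mx g sg); rewrite le_eqVlt => /orP[/eqP-> //|gx].
by apply: ltnW; exact: gP.
Qed.

Definition ladder_edge : rel (set W) :=
  fun r t => `[< [/\ node r, node t & below r t \/ below t r] >].

Fact ladder_edge_sym : symmetric ladder_edge.
Proof.
by move=> r t; apply: asbool_equiv_eq; split=> -[nr nx rx]; split=> //; exact/or_comm.
Qed.

Fact ladder_edge_irr : irreflexive ladder_edge.
Proof. by move=> t; apply/asboolP => -[_ _ []] /below_irr. Qed.

Fact ladder_edge_vertices (r x : set W) : ladder_edge r x -> node r /\ node x.
Proof. by move=> /asboolP[]. Qed.

Definition ladder_graph : graph (set W) :=
  Graph ladder_edge_sym ladder_edge_irr ladder_edge_vertices.

Lemma ladder_graph_sub : subgraph ladder_graph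
  (comparability_graph (closed_countable_subsets S) (@initial_segment d W)).
Proof.
split=> [t []//|r x /asboolP[[Tr _] [Tx _] rx]]; apply/asboolP; split=> //.
  by move=> xr; subst; case: rx => /below_irr.
by case: rx => /iseg_below; [left|right].
Qed.

(** * Uncountable sets of nodes are not [omega]-connected *)

Section Connected.
Variable A : set (set W).
Hypotheses (S_costat : stationary (~` S)) (A_node : A `<=` node)
  (A_unc : ~ countable A) (A_conn : omega_connected (induced ladder_graph A)).

(** Finiteness is what separation needs; by [finite_below], every node whose maximum is not a limit
    is good. *)
Definition good s := node s /\ finite_set [set r | node r /\ below r s].

(** Otherwise the finitely many lower neighbours of [s] in [A] would separate [u], in the cone above
    [s], from [v], outside it. *)
Lemma connected_cone s u v : good s -> A u -> initial_segment s u -> A v ->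
  initial_segment s v \/ below v s.
Proof.
move=> [ns fs] Au su Av; apply: contrapT => /not_orP[nsv nvs].
apply: A_conn; exists u, v, (A `&` [set r | node r /\ below r s]).
split; [by split=> //; exact: A_node|by split=> //; exact: A_node|by move=> uv; subst|].
split; [|exact: finite_setIr|].
  move=> r [Ar [nr rs]]; split; first by split.
  by move=> [] /= rE; [apply: (below_proper rs); rewrite rE|apply: nvs; rewrite -rE].
(* The first vertex of the path outside the cone is reached by a downward edge, so [below_exit] puts
   it in the separator. *)
move=> p + _; elim: p u su {Au} => [|w p IH] u su /=; first by move=> _ uv; subst.
move=> /andP[/and3P[/asboolP[_ nw uw] _ /set_mem Aw] wp] wv.
have [sw|nsw] := pselect (initial_segment s w).
  by have [z zp Fz] := IH w sw wp wv; exists z => //; rewrite inE zp orbT.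
exists w; first by rewrite !inE eqxx orbT.
split=> //; split=> //; case: uw => [/iseg_below uw|wu]; last exact: below_exit su wu nsw.
by case: nsw; exact: iseg_trans uw.
Qed.

Definition branch := [set s | good s /\ exists2 a, A a & initial_segment s a].

(** Some [c] in the uncountable [A] is a lower neighbour of neither [s] nor [r], so by
    [connected_cone] both are initial segments of [c]. *)
Lemma branch_total s r : branch s -> branch r ->
  initial_segment s r \/ initial_segment r s.
Proof.
move=> [gs [a Aa sa]] [gr [b Ab rb]].
have /uncountable_neq0[c [Ac /not_orP[ncs ncr]]] := uncountable_setD A_unc
  (countable_setU (finite_set_countable gs.2) (finite_set_countable gr.2)).
have [sc|cs] := connected_cone gs Aa sa Ac; last first.
  by case: ncs; split=> //; exact: A_node.
have [rc|cr] := connected_cone gr Ab rb Ac; last first.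
  by case: ncr; split=> //; exact: A_node.
exact: iseg_total rc.
Qed.

(** Otherwise the union of the chain would be a club inside [S], contradicting co-stationarity. *)
Lemma branch_bounded : exists b, forall s, branch s -> forall x, s x -> (x <= b)%O.
Proof.
apply: contrapT => nb; pose C := \bigcup_(s in branch) s.
have [|y [nSy [s Bs sy]]] := S_costat (C := C); last first.
  by apply: nSy; have [[[[+ _ _] _] _] _] := Bs; apply.
split; last first.
  move=> a; apply: contrapT => na; apply: nb; exists a => s Bs x sx.
  by rewrite leNgt; apply/negP => ax; apply: na; exists x => //; exists s.
apply/closed_limitP => y ly.
have [b [s Bs sb] yb] : exists2 b, C b & (y < b)%O.
  apply: contrapT => nC; apply: nb; exists y => s Bs x sx.
  by rewrite leNgt; apply/negP => yx; apply: nC; exists x => //; exists s.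
exists s => //; have [[ns _] _] := Bs; apply: (node_limit ns).
apply: sub_limit_of ly => w wy [r Br rw].
have [[_ sri]|[rs _]] := branch_total Bs Br; last exact: rs.
by apply: (sri _ b) => //; exact: ltW (lt_trans wy yb).
Qed.

(** The maximum is injective on a chain of nodes, and its values are bounded by [branch_bounded]. *)
Lemma branch_countable : countable branch.
Proof.
have maxP t : exists x, node t -> max_of t x.
  have [nt|nt] := pselect (node t); last first.
    by have [z _] := uncountable_neq0 omega1_uncountable ; exists z.
  by have [x tx] := node_max nt; exists x.
have [mx mxP] := choice maxP; have [b Bb] := branch_bounded.
apply: (countable_inj_image (f := mx) _ _ (omega1_countable_le b)).
  by move=> s Bs /=; apply: (Bb s) => //; have [/mxP[]] := Bs.1.
have sub s r : branch s -> branch r -> mx s = mx r -> s `<=` r.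
  move=> Bs Br srE; have [/mxP[smx sm] _] := Bs.1; have [/mxP[rmx rm] _] := Br.1.
  have [[]//|[rs rsi]] := branch_total Bs Br.
  by move=> x sx; apply: (rsi _ (mx r)) => //; rewrite -srE; exact: sm.
by move=> s r Bs Br srE; apply/seteqP; split; apply: sub.
Qed.

Lemma not_good_limit (a : set W) : node a -> ~ good a -> exists2 x, max_of a x & limit_of a x.
Proof.
move=> na nga; have [x ax] := node_max na; exists x => //.
apply: contrapT => nl; apply: nga; split=> //; exact: finite_below ax nl.
Qed.

(** The truncations of [a] at successor points of [a] belong to [branch] and exhaust [a] up to its
    maximum, a limit that the closed [a'] contains as well. *)
Lemma not_good_sub (a a' : set W) : A a -> ~ good a -> node a' ->
  (forall s, branch s -> initial_segment s a') -> a `<=` a'.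
Proof.
move=> Aa nga na' Ba'; have na := A_node Aa.
have [x [ax mx] lx] := not_good_limit na nga.
have sub y : (y < x)%O -> a y -> a' y.
  move=> yx ay; have [w0 [aw0 yw0 w0x]] := lx.2 y yx.
  (* [w] is the next point of [a] after [y], hence not a limit, so the truncation of [a] at [w] is
     good. *)
  have [|w [aw yw] minw] := @omega1_min [set w | a w /\ (y < w)%O].
    by exists w0.
  pose s := [set v | a v /\ (v <= w)%O].
  have ns : node s by exact: node_trunc.
  have gs : good s.
    split=> //; apply: (@finite_below _ w) => //; first by split=> // v [].
    move=> [_ /(_ y yw)[v [[av _] yv vw]]].
    by move: vw; rewrite ltNge minw.
  have [sa' _] : initial_segment s a'.
    by apply: Ba'; split=> //; exists a => //; exact: iseg_trunc.
  by apply: sa'; split=> //; exact: ltW.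
move=> y ay; move: (mx y ay); rewrite le_eqVlt => /orP[/eqP->|yx]; last exact: sub.
by apply: (node_limit na'); exact: sub_limit_of lx.
Qed.

Lemma uncountable_not_omega_connected : False.
Proof.
pose A1 := [set a | A a /\ forall s, branch s -> initial_segment s a].
have uA1 : ~ countable A1.
  have cF : countable (\bigcup_(s in branch) [set r | node r /\ below r s]).
    apply: bigcup_countable => [|s [[_ /finite_set_countable]]//].
    exact: branch_countable.
  move=> cA1; apply: (uncountable_setD A_unc cF); apply: countable_subset cA1.
  move=> a [Aa nFa]; split=> // s Bs; have [gs [b Ab sb]] := Bs.
  have [//|as_] := connected_cone gs Ab sb Aa; case: nFa; exists s => //.
  by split=> //; exact: A_node.
have goodA1 (a a' : set W) : A1 a -> good a -> A1 a' -> initial_segment a a'.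
  by move=> [Aa _] ga [_]; apply; split=> //; exists a => //; exact: iseg_refl.
(* Good members of [A1] are in [branch], hence initial segments of one another: there is at most
   one. *)
have ugood : ~ countable (A1 `\` good).
  move=> cng; apply: (uncountable_setD uA1 cng).
  apply: (countable_inj_image (B := [set tt]) (f := fun=> tt)) => //.
  have A1good (a : set W) : (A1 `\` (A1 `\` good)) a -> A1 a /\ good a.
    by move=> [A1a nga]; split=> //; apply: contrapT => nga'; apply: nga.
  move=> a a' /A1good[A1a ga] /A1good[A1a' ga'] _; apply/seteqP.
  by split; [case: (goodA1 a a')|case: (goodA1 a' a)].
have [a [A1a nga]] := uncountable_neq0 ugood.
have [a' [[A1a' nga'] /= aa']] := uncountable_neq0 (uncountable_setD ugood (countable1 a)).
apply: aa'; apply/seteqP.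
case: A1a => Aa Ba; case: A1a' => Aa' Ba'.
by split; apply: not_good_sub => //; exact: A_node.
Qed.

End Connected.
(** Maxima strictly increase along [below], so the maximum is a proper colouring by points of
    [W]. *)
Lemma ladder_color_max (b : W) : independent ladder_graph [set t | node t /\ max_of t b].
Proof.
have lt_max (r t : set W) : max_of r b -> max_of t b -> ~ below r t.
  by move=> [rb _] [_ tb] [g [tg rE _]]; move: rb; rewrite rE => -[_]; rewrite ltNge tb.
split=> [t []//|r t [_ rb] [_ tb]]; apply/negP => /asboolP[_ _ []].
  exact: lt_max.
exact: lt_max.
Qed.

(** * No colouring of the ladder graph by natural numbers is proper *)

Section Colouring.
Hypotheses (S_stat : stationary S)
  (h_unbounded : forall n a, exists g, [/\ S g, (a < g)%O & h g = n]).
Variable col : set W -> nat.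

Definition grow n (u t : set W) := [/\ node t, initial_segment u t
  & forall y, t y -> ~ u y -> ~ limit_of t y -> (n < h y)%N].

(** One stage: from [p = (u, n, b)], take [t] of colour [n] if possible, then a point [g] of label
    [n.+1] beyond both [t] and the requested bound [b]. *)
Lemma grow_step (p : set W * nat * W) : exists q : set W * W, node p.1.1 ->
  [/\ grow p.1.2 p.1.1 q.1,
      (exists2 x, grow p.1.2 p.1.1 x & col x = p.1.2) -> col q.1 = p.1.2,
      forall y, q.1 y -> (y < q.2)%O,
      S q.2 & h q.2 = p.1.2.+1 /\ (p.2 < q.2)%O].
Proof.
case: p => -[u n] b /=; have [nu|nu] := pselect (node u); last by exists (u, b).
have [t gt tn] : exists2 t, grow n u t
    & (exists2 x, grow n u x & col x = n) -> col t = n.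
  have [[x gx xn]|nx] := pselect (exists2 x, grow n u x & col x = n).
    by exists x.
  by exists u => //; split=> //; exact: iseg_refl.
have [nt _ _] := gt; have [x [_ xm]] := node_max nt.
have [g [Sg xbg hg]] := h_unbounded n.+1 (Order.max x b).
move: xbg; rewrite gt_max => /andP[xg bg].
by exists (t, g) => _; split=> //= y /xm /le_lt_trans; apply.
Qed.

Lemma iseg_add t g : (forall y, t y -> (y < g)%O) -> initial_segment t (t `|` [set g]).
Proof.
move=> tg; split=> [y|y z [//|->] tz]; first by left.
by rewrite leNgt tg.
Qed.

(* Along a sequence [u_0 <= t_0 < u_1 <= t_1 < ...] whose supremum lies in [S],
   the node [t_n] receives colour [n] if any [x >= u_n] whose new labels exceed
   [n] has this colour.  The limit is such an [x] for every [n]; so if its colour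
   is [n], then [t_n] has the same colour. *)
Lemma ladder_monochromatic : exists r x : set W,
  [/\ node r, node x, below r x & col r = col x].
Proof.
have [step stepP] := choice grow_step.
have [w0 _] := uncountable_neq0 omega1_uncountable.
have [g0 [Sg0 _ _]] := h_unbounded 0 w0.
(* The construction runs along every finite list of requested bounds, latest first, because the
   requests to use are known only once the limit [b] is chosen. *)
pose strat := fix strat (l : seq W) : set W := if l is b :: l'
  then let q := step (strat l', size l', b) in q.1 `|` [set q.2] else [set g0].
have n_strat l : node (strat l).
  elim: l => [|b l IH] /=.
    split; last by exists g0.
    split; [by move=> _ -> | exact: countable1|].
    apply/closed_limitP => y [[z zy] ly] /=.
    have [w1 [/= -> zg gy]] := ly z zy.
    by have [w2 [/= ->]] := ly _ gy; rewrite ltxx.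
  have /= [[nt _ _] _ tq Sq _] := stepP (strat l, size l, b) IH.
  have [x [tx xm]] := node_max nt.
  by apply: (@node_add _ x) => //; exact: tq.
have [mx mxP] := choice (fun l => node_max (n_strat l)).
(* Runs with all requests below [b] stay below [b]; requesting an enumeration of the points below
   [b] makes [b] the supremum. *)
have [b [Sb bC]] := S_stat (finite_closed_under_closure_points mx).
have [|g [gb bg]] := countable_enumeration (omega1_countable_lt b).
  by exists (mx [::]); exact: bC.
pose L := fix L n := if n is m.+1 then g m :: L m else [::].
have size_L n : size (L n) = n by elim: n => //= n ->.
have L_lt n : all (fun x => x < b)%O (L n) by elim: n => //= n ->; rewrite gb.
pose u n := strat (L n); pose q n := step (u n, n, g n).
have uS n : u n.+1 = (q n).1 `|` [set (q n).2] by rewrite /u /= size_L.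
have nu n : node (u n) by exact: n_strat.
have qP n := stepP (u n, n, g n) (nu n); rewrite -/(q _) /= in qP.
have u_lt n y : u n y -> (y < b)%O.
  by move=> /(mxP _).2 /le_lt_trans; apply; exact: bC.
have q_lt n : (q n).2 \in `]g n, b[%O.
  rewrite in_itv/=; have [_ _ _ _ [_ ->]] := qP n.
  by apply: (u_lt n.+1); rewrite uS; right.
have tu n : initial_segment (q n).1 (u n.+1).
  by rewrite uS; apply: iseg_add; have [] := qP n.
have uu m n : (m <= n)%N -> initial_segment (u m) (u n).
  elim: n => [|n IH]; first by rewrite leqn0 => /eqP->; exact: iseg_refl.
  rewrite leq_eqVlt => /orP[/eqP->|/IH umn]; first exact: iseg_refl.
  apply: iseg_trans umn _; apply: iseg_trans (tu n).
  by have [[]] := qP n.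
pose x := \bigcup_n u n `|` [set b].
have ux n : initial_segment (u n) x.
  split=> [y uy|y z]; first by left; exists n.
  move=> [[m _ uy]|->] uz yz; last by move: (u_lt _ _ uz); rewrite ltNge yz.
  have [mn|/ltnW nm] := leqP m n; first exact: (uu _ _ mn).1.
  exact: (uu _ _ nm).2 uy uz yz.
have below_b z : (z < b)%O -> exists2 n, u n (q n.-1).2 & (z < (q n.-1).2)%O.
  move=> /bg[n <-]; exists n.+1; first by rewrite uS; right.
  by have := q_lt n; rewrite in_itv/= => /andP[].
have lim_b : limit_of x b.
  split; first by exists (g 0%N); exact: gb.
  move=> z /below_b[n uq zq]; exists (q n.-1).2; split=> //; last exact: u_lt uq.
  exact: (ux n).1.
have nx : node x.
  split; last by exists b; right.
  split.
  - by move=> y [[n _]|->//]; have [[+ _ _] _] := nu n; apply.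
  - apply: countable_setU (countable1 b); apply: bigcup_countable => // n _.
    by have [[]] := nu n.
  - apply/closed_limitP => y ly; case: (ltgtP y b) => [/below_b[n uq yq]|by_|->];
      last by right.
      by left; exists n => //; apply: (node_limit (nu n)); exact: iseg_limit uq (ltW yq) ly.
    have [v [[[n _ /u_lt vb]|->] bv _]] := ly.2 b by_; last by rewrite ltxx in bv.
    by move: vb; rewrite ltNge (ltW bv).
(* Points added at a stage [m >= n] either have label [m.+1], or are limits, or have label above [m]
   by [grow]. *)
have u_grow n m y : u m y -> ~ u n y -> ~ limit_of (u m) y -> (n < h y)%N.
  elim: m => [|m IH] umy nuy nly.
    by case: nuy; exact: (uu 0%N n (leq0n n)).1.
  have nm : (n <= m)%N.
    by rewrite leqNgt; apply/negP => mn; apply: nuy; exact: (uu _ _ mn).1.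
  have [gm _ _ _ [hq _]] := qP m; have [_ ut hm] := gm.
  move: (umy); rewrite uS => -[ty|->]; last by rewrite hq ltnS.
  have [uy|nuy'] := pselect (u m y).
    apply: IH => // ly; apply: nly; apply: sub_limit_of ly => w _ uw.
    exact: (uu _ _ (leqnSn m)).1.
  apply: leq_ltn_trans nm _; apply: hm => // ly; apply: nly.
  by apply: sub_limit_of ly => w _; exact: (tu m).1.
have x_grow n : grow n (u n) x.
  split=> // y [[m _ uy]|->//] nuy nly; apply: u_grow uy nuy _ => ly; apply: nly.
  by apply: sub_limit_of ly => w _; exact: (ux m).1.
pose n := col x; have [[nt _ _] tn tq _ [hq _]] := qP n.
exists (q n).1, x; split=> //; last by apply: tn; exists x.
have uq : u n.+1 (q n).2 by rewrite uS; right.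
exists (q n).2; split.
- exact: (ux n.+1).1.
- apply/seteqP; split=> y /=.
    by move=> ty; split; [apply: (ux n.+1).1; exact: (tu n).1|exact: tq].
  move=> [xy yq]; have := (ux n.+1).2 _ _ xy uq (ltW yq).
  by rewrite uS => -[//|yE]; move: yq; rewrite yE ltxx.
(* Points of [x] after [(q n).2] lie outside [u n.+1], so their non-limit labels exceed [n.+1], the
   label of [(q n).2]. *)
- have [_ _ xg] := x_grow n.+1 => y xy qy nly; rewrite hq.
  apply: xg => //; rewrite uS => -[/tq yq|yE].
    by move: qy; rewrite ltNge (ltW yq).
  by move: qy; rewrite yE ltxx.
Qed.

End Colouring.
End Tree.

(** * Labelling of [S] and the final assembly *)

Lemma stationary_labels S : stationary S -> exists h : W -> nat,
  forall n a, exists g, [/\ S g, (a < g)%O & h g = n].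
Proof.
move=> S_stat.
(* A countable tail of [S] would be bounded, and [S] would miss a final segment of [W], which is a
   club. *)
have uS a : ~ countable (S `&` [set x | (a < x)%O]).
  move=> /omega1_above_countable[b Sb].
  have [|x [Sx /= /andP[ax bx]]] := S_stat [set x | (a < x)%O && (b <= x)%O].
    split; last first.
      move=> z; have [y yP] := omega1_above_countable
        (countable_setU (countable_setU (countable1 z) (countable1 a)) (countable1 b)).
      exists y; last by apply: yP; left; left.
      by rewrite /= yP ?ltW ?yP//; [right|left; right].
    apply/closed_limitP => y /limit_of_max[z /= /andP[az bz] zy].
    by rewrite (lt_trans az zy) (le_trans bz (ltW zy)).
  by have := Sb x (conj Sx ax); rewrite ltNge bx.
(* The point [G a n] of [S] above [a] is to carry label [n]; distinctness makes this consistent. *)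
have [G [GS G_inj]] := disjoint_sequences uS.
have hP x : exists m, forall a n, G a n = x -> m = n.
  have [[n [a Gx]]|nx] := pselect (exists n a, G a n = x).
    by exists n => a' n' G'x; have [] := G_inj a a' n n' (etrans Gx (esym G'x)).
  by exists 0%N => a n Gx; case: nx; exists n, a.
have [h hG] := choice hP; exists h => n a.
exists (G a n); have [SG aG] := GS a n; split=> //; exact: hG (erefl _).
Qed.

End Omega1.

Theorem theorem1 (d : Order.disp_t) (W : orderTopologicalType d)
    (W_omega1 : is_omega1 W) (S : set W)
    (S_stat : stationary S) (S_costat : stationary (~` S)) :
  exists X : graph (set W),
    [/\ subgraph X
          (comparability_graph (closed_countable_subsets S) (@initial_segment d W)),
        chromatic_number_is X W
      & forall A : set (set W), A `<=` vertices X -> ~ countable A ->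
          ~ omega_connected (induced X A)].
Proof.
have [h hP] := stationary_labels W_omega1 S_stat.
exists (ladder_graph S h); split; first exact: ladder_graph_sub.
  split.
    exists (fun b => [set t | node S t /\ max_of t b]).
      exact: ladder_color_max.
    apply/seteqP; split=> [t [b _ []//]|t nt].
    by have [b tb] := node_max W_omega1 nt; exists b.
  move=> K [U U_ind UV].
  (* A countable [K] would code a colouring by natural numbers, with [0] outside the nodes, and
     [ladder_monochromatic] gives an edge inside one colour class. *)
  have uK : ~ countable [set: K].
    move=> /countable_injP[f f_inj].
    have colP t : exists n, node S t -> exists2 k, U k t & f k = n.
      have [nt|nt] := pselect (node S t); last by exists 0%N.
      have [k _ Ukt] : (\bigcup_k U k) t by rewrite UV.
      by exists (f k) => _; exists k.
    have [col {}colP] := choice colP; have [r [x [nr nx rx crx]]] :=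
      ladder_monochromatic W_omega1 S_stat hP col.
    have [k Ukr fk] := colP r nr; have [k' Ukx fk'] := colP x nx.
    have kk' : k = k' by apply: f_inj; rewrite ?inE// fk fk'.
    have := (U_ind k).2 r x Ukr; rewrite kk' => /(_ Ukx)/negP; apply.
    by apply/asboolP; split=> //; left.
  (* The first terms of disjoint sequences in the uncountable [K] inject [W] into [K]. *)
  have [G [_ G_inj]] := disjoint_sequences W_omega1 (fun=> uK).
  have G0_inj : {in [set: W] &, injective (G^~ 0%N)} by move=> a b _ _ /G_inj[].
  by have := inj_card_eq G0_inj; rewrite card_eq_le => /andP[_ /card_le_trans]; apply;
    exact: subset_card_le.
move=> A A_node A_unc A_conn.
exact: (uncountable_not_omega_connected W_omega1 S_costat A_node A_unc A_conn).
Qed.
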